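(* Let $f(x)=x^5+c_4x^4+c_3x^3+c_2x^2+c_1x+c_0$ be a monic polynomial of degree $5$ with integer coefficients. Then $f(x)$ is a Cappell-Shaneson polynomial if and only if there are integers $a$ and $b$ such that $(c_0,c_1,c_2,c_3,c_4)$ equals one of the following: (I-i-1) $(-1,\ -a+1,\ 2a+1,\ -2a-1,\ a)$; (I-i-2) $(-1,\ -2a+2,\ 5a,\ -5a-1,\ 2a)$; (I-i-3) $(-1,\ -a-1,\ 4a+15,\ -4a-13,\ a)$; (I-i-4) $(-1,\ -2a-2,\ 7a+13,\ -7a-10,\ 2a)$; (I-ii-1) $(-1,\ -a,\ -b+1,\ b,\ a)$; (I-ii-2) $(-1,\ (-b+1)a+5,\ (3b-2)a-b-9,\ (-3b+1)a+b+10,\ ab-5)$; (II-i-1) $(-1,\ -a+1,\ 4a+9,\ -4a-11,\ a)$; (II-i-2) $(-1,\ -2a+2,\ 7a+3,\ -7a-6,\ 2a)$; (II-i-3) $(-1,\ -a-1,\ 2a+3,\ -2a-3,\ a)$; (II-i-4) $(-1,\ -2a-2,\ 5a+6,\ -5a-5,\ 2a)$; (II-ii-1) $(-1,\ -a,\ -b-1,\ b,\ a)$; (II-ii-2) $(-1,\ (-b+1)a+5,\ (3b-2)a+b-11,\ (-3b+1)a-b+10,\ ab-5)$.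
   Context: For $n\ge 2$, a matrix $A\in\mathrm{SL}(n,\mathbb{Z})$ is a Cappell-Shaneson matrix of order $n$ if for every $k\in\{1,\ldots,[n/2]\}$ one has $\det(I-\bigwedge^kA)\in\{1,-1\}$, where $\bigwedge^k A$ is the $k$-th exterior power of $A$ and $I$ is the identity matrix. A monic integer polynomial of degree $n$ is a Cappell-Shaneson polynomial of degree $n$ if it is the characteristic polynomial of some Cappell-Shaneson matrix of order $n$. *)

(* Defs.v *)
From mathcomp Require Import all_boot all_order all_algebra.

Set Implicit Arguments.
Unset Strict Implicit.
Unset Printing Implicit Defensive.

Import GRing.Theory.
Local Open Scope ring_scope.

(* The tuples (i_1 < ... < i_k) label the standard basis vectors
   e_(i_1) /\ ... /\ e_(i_k) of the k-th exterior power of R^n. *)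
Definition wedge_index (n k : nat) : {set k.-tuple 'I_n} :=
  [set t : k.-tuple 'I_n | sorted ltn [seq val i | i <- t]].

Lemma card_wedge_index (n k : nat) : #|wedge_index n k| = 'C(n, k).
Proof. exact: card_ltn_sorted_tuples. Qed.

(* Matrix of the k-th exterior power of A in the standard basis: its (I, J)
   entry is the k x k minor of A with rows I and columns J. *)
Definition exterior_power (R : comNzRingType) (n k : nat) (A : 'M[R]_n) :
    'M[R]_(#|wedge_index n k|) :=
  \matrix_(i, j) \det (mxsub (tnth (enum_val i)) (tnth (enum_val j)) A).

Definition cappell_shaneson_matrix (n : nat) (A : 'M[int]_n) : Prop :=
  [/\ (2 <= n)%N,
      \det A = 1
    & forall k : nat, (1 <= k <= n./2)%N ->
        \det (1%:M - exterior_power k A) = 1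
        \/ \det (1%:M - exterior_power k A) = -1].

Definition cappell_shaneson_poly (n : nat) (f : {poly int}) : Prop :=
  [/\ f \is monic,
      size f = n.+1
    & exists2 A : 'M[int]_n, cappell_shaneson_matrix A & f = char_poly A].

(* Main.v *)
Require Import Defs.
From mathcomp Require Import all_boot all_order all_fingroup all_algebra.
From mathcomp Require Import spectral algC ring zify.

(* Over the algebraic numbers A is similar to a lower triangular matrix, and by
   Cauchy-Binet exterior powers are multiplicative, so det(I - /\^k A) is the
   product of 1 - lam_(i_1) ... lam_(i_k) over i_1 < ... < i_k. For n = 5 this
   is f(1) when k = 1 and, when k = 2, a polynomial in the coefficients of f;
   the companion matrix then realises every f meeting the numerical conditions.
   With c0 = -1, f(1) = e and s = c1 + c4, the condition for k = 2 becomes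
   s m = 0 or s m = 2 for some m linear in c3, c4 once s is fixed: s = 0 and
   m = 0 give the two-parameter families, the four factorisations of 2 the
   others. *)

Set Implicit Arguments.
Unset Strict Implicit.
Unset Printing Implicit Defensive.

Import GRing.Theory Num.Theory.
Local Open Scope ring_scope.

(** * Increasing index tuples and the Cauchy-Binet formula *)

Lemma wedge_index_uniq (n k : nat) (s : k.-tuple 'I_n) :
  s \in wedge_index n k -> uniq s.
Proof.
rewrite inE => /(sorted_uniq ltn_trans ltnn).
by rewrite map_inj_uniq //; exact: val_inj.
Qed.

Lemma tnth_wedge_inj (n k : nat) (s : k.-tuple 'I_n) :
  s \in wedge_index n k -> injective (tnth s).
Proof. by move=> sW; apply/tuple_uniqP/(wedge_index_uniq sW). Qed.

(** A strictly increasing sequence is determined by its set of entries, and a permutation of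
    positions preserves that set. *)
Lemma wedge_index_perm (n k : nat) (s t : k.-tuple 'I_n) (p : 'S_k) :
  s \in wedge_index n k -> t \in wedge_index n k ->
  (forall i, tnth s i = tnth t (p i)) -> s = t.
Proof.
rewrite !inE => sS tS st.
apply: val_inj => /=; apply: (inj_map val_inj).
apply: (irr_sorted_eq ltn_trans ltnn) => // x.
suff st' : s =i t.
  by apply/mapP/mapP => -[y yin ->]; exists y; rewrite // ?st' // -st'.
move=> y; apply/tnthP/tnthP => -[i ->].
  by exists (p i).
by exists ((p^-1)%g i); rewrite st permKV.
Qed.

(** The tuple is the sorted list of values of [h]; injectivity makes the order strict, and [p]
    undoes the sorting. *)
Lemma injective_wedge_perm (n k : nat) (h : 'I_k -> 'I_n) : injective h ->
  exists2 s, s \in wedge_index n k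
           & exists p : 'S_k, forall i, h i = tnth s (p i).
Proof.
move=> inj_h; pose e := [seq h i | i <- enum 'I_k].
have e_uniq : uniq e by rewrite map_inj_uniq // enum_uniq.
pose r := relpre (@nat_of_ord n) leq.
have sz : size (sort r e) == k by rewrite size_sort size_map size_enum_ord.
exists (Tuple sz).
  rewrite inE /= ltn_sorted_uniq_leq map_inj_uniq; last exact: val_inj.
  rewrite sort_uniq e_uniq /=.
  rewrite sorted_map; apply: sort_sorted => x y; exact: leq_total.
have: perm_eq [tuple h i | i < k] (Tuple sz).
  by rewrite perm_sym /= perm_sort.
case/tuple_permP=> p eq_p; exists p => i.
have /val_inj {}eq_p :
  val [tuple h i | i < k] = val [tuple tnth (Tuple sz) (p i) | i < k] by [].
by move/(congr1 (fun t => tnth t i)): eq_p; rewrite !tnth_mktuple.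
Qed.

(** Expanding the product gives a sum over all maps [h] that choose a summation index in each row. A
    map that is not injective repeats a row of [B] and contributes 0. An injective one is uniquely
    an increasing tuple [s] after a permutation [p], and for fixed [s] the sum over [p] rebuilds the
    minor of [A]. *)
Lemma Cauchy_Binet (R : comNzRingType) (n k : nat)
    (A : 'M[R]_(k, n)) (B : 'M[R]_(n, k)) :
  \det (A *m B) = \sum_(s in wedge_index n k)
                    \det (colsub (tnth s) A) * \det (rowsub (tnth s) B).
Proof.
pose F (h : {ffun 'I_k -> 'I_n}) :=
  \prod_i A i (h i) * \det (rowsub h B).
have ->: \det (A *m B) = \sum_h F h.
  pose AB (p : 'S_k) i j := A i j * B j (p i).
  transitivity (\sum_(h : {ffun 'I_k -> 'I_n}) \sum_(p : 'S_k)
                  (-1) ^+ p * \prod_i AB p i (h i)).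
    rewrite exchange_big; apply: eq_bigr => /= p _; rewrite -big_distrr /=.
    congr (_ * _); rewrite -(bigA_distr_bigA (AB p)) /=.
    by apply: eq_bigr => x _; rewrite mxE.
  apply: eq_bigr => h _; rewrite /F big_distrr /=; apply: eq_bigr => p _.
  rewrite mulrCA big_split //=; congr (_ * (_ * _)).
  by apply: eq_bigr => i _; rewrite mxE.
rewrite (bigID (fun h : {ffun 'I_k -> 'I_n} => injectiveb h)) /= addrC.
rewrite big1 ?add0r => [|h /injectivePn[i1 [i2 ne12 eq12]]]; last first.
  rewrite /F (determinant_alternate ne12) ?mulr0 // => j.
  by rewrite !mxE eq12.
pose comp (x : k.-tuple 'I_n * 'S_k) : {ffun 'I_k -> 'I_n} :=
  [ffun i => tnth x.1 (x.2 i)].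
pose D := [set x : k.-tuple 'I_n * 'S_k | x.1 \in wedge_index n k].
have compE : [set h : {ffun 'I_k -> 'I_n} | injectiveb h] = comp @: D.
  apply/setP => h; rewrite inE; apply/injectiveP/imsetP => [|[[s p]]].
    case/injective_wedge_perm=> s sW [p hE]; exists (s, p).
      by rewrite [_ \in D]in_set.
    by apply/ffunP => i; rewrite ffunE hE.
  rewrite [_ \in D]in_set /= => sW -> i j; rewrite !ffunE /=.
  move=> /(tnth_wedge_inj sW); exact: perm_inj.
have comp_inj : {in D &, injective comp}.
  move=> [s p] [t q]; rewrite ![_ \in D]in_set /= => sW tW eq_st.
  have {eq_st}eq_comp i : tnth s (p i) = tnth t (q i).
    have := congr1 (fun h : {ffun 'I_k -> 'I_n} => h i) eq_st.
    by rewrite !ffunE.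
  have st : s = t.
    apply: (wedge_index_perm (p := p^-1 * q)) => // i.
    by have := eq_comp ((p^-1)%g i); rewrite permKV permM.
  congr (_, _) => //; apply/permP => i; apply: (tnth_wedge_inj sW).
  by rewrite eq_comp st.
rewrite (eq_bigl (fun h => h \in comp @: D)) ?big_imset //=; last first.
  by move=> h; rewrite -compE inE.
transitivity (\sum_(s in wedge_index n k) \sum_(p : 'S_k) F (comp (s, p))).
  rewrite pair_big_dep /=; apply: eq_big => [[s p]|[s p] _] //=.
  by rewrite [_ \in D]in_set andbT.
apply: eq_bigr => s _; rewrite big_distrl /=; apply: eq_bigr => p _.
(* Sorting the rows of [B] costs the sign of [p], which is the sign needed in the Leibniz formula
   for the minor of [A]. *)
have rowE : rowsub (comp (s, p)) B = perm_mx p *m rowsub (tnth s) B.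
  by rewrite -row_permE; apply/matrixP => i j; rewrite !mxE ffunE.
rewrite /F rowE det_mulmx det_perm mulrCA mulrA; congr (_ * _ * _).
by apply: eq_bigr => i _; rewrite ffunE mxE.
Qed.

(** * Multiplicativity of exterior powers and the triangular case *)

Lemma exterior_powerM (R : comNzRingType) (n k : nat) (A B : 'M[R]_n) :
  exterior_power k (A *m B) = exterior_power k A *m exterior_power k B.
Proof.
apply/matrixP => i j; rewrite !mxE mxsub_mul Cauchy_Binet big_enum_val.
apply: eq_bigr => l _; rewrite !mxE; congr (_ * _); congr determinant;
  by apply/matrixP => a b; rewrite !mxE.
Qed.

(* The weight of a basis vector e_(s_1) /\ ... /\ e_(s_k) is the sum of its
   indices; a lower triangular matrix can only lower it. *)
Lemma trig_minor_eq0 (R : comNzRingType) (n k : nat) (T : 'M[R]_n)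
    (s t : k.-tuple 'I_n) :
  is_trig_mx T -> s \in wedge_index n k -> t \in wedge_index n k -> s != t ->
  (\sum_i tnth s i <= \sum_i tnth t i)%N ->
  \det (mxsub (tnth s) (tnth t) T) = 0.
Proof.
move=> /is_trig_mxP trT sW tW ne_st le_st; apply: big1 => p _.
have [i lt_i | ge_p] := pickP (fun i => tnth s i < tnth t (p i))%N.
  by rewrite (bigD1 i) //= mxE trT // mul0r mulr0.
case/eqP: ne_st; apply: (wedge_index_perm (p := p)) => // i.
have le_p j : true -> (tnth t (p j) <= tnth s j)%N by rewrite leqNgt ge_p.
apply/val_inj/eqP; rewrite eqn_leq le_p // andbT leqNgt; apply/negP => lt_i.
move: le_st; rewrite leqNgt => /negP[].
rewrite (reindex_perm p) (bigD1 i) //= [X in (_ < X)%N](bigD1 i) //=.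
by rewrite -addSn leq_add //; apply: leq_sum => j _; exact: le_p.
Qed.

(** Since the index tuple increases, the principal submatrix it selects is again lower
    triangular. *)
Lemma exterior_power_trig_diag (R : comNzRingType) (n k : nat)
    (T : 'M[R]_n) i :
  is_trig_mx T ->
  exterior_power k T i i =
    \prod_j T (tnth (enum_val i) j) (tnth (enum_val i) j).
Proof.
move=> trT; have := enum_valP i; set s := enum_val i => sW.
rewrite mxE det_trig -/s; first by apply: eq_bigr => j _; rewrite mxE.
apply/is_trig_mxP => a b lt_ab; rewrite mxE (is_trig_mxP trT) //.
rewrite inE in sW.
have := sorted_ltn_nth ltn_trans 0%N sW.
move=> /(_ a b); rewrite !inE !size_map !size_tuple !ltn_ord.
move=> /(_ isT isT lt_ab).
by rewrite !(nth_map (tnth s a)) ?size_tuple // -!tnth_nth.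
Qed.

Lemma exterior_power1 (R : comNzRingType) (n k : nat) :
  exterior_power k (1%:M : 'M[R]_n) = 1%:M.
Proof.
apply/matrixP => i j; have [-> | ne_ij] := eqVneq i j.
  rewrite exterior_power_trig_diag ?scalar_mx_is_trig // mxE eqxx.
  rewrite big1 // => l _.
  by rewrite mxE eqxx.
rewrite !mxE (negPf ne_ij).
have ne_st : enum_val i != enum_val j by rewrite (inj_eq enum_val_inj).
have tr1 : is_trig_mx (1%:M : 'M[R]_n) by exact: scalar_mx_is_trig.
set s := enum_val i; set t := enum_val j.
case: (leqP (\sum_l tnth s l) (\sum_l tnth t l)) => [le_st | /ltnW le_ts].
  by apply: trig_minor_eq0; rewrite ?enum_valP.
(* The identity is its own transpose, so transposing the minor swaps the two tuples and puts the
   weights in the required order. *)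
rewrite -det_tr trmx_mxsub trmx1; apply: trig_minor_eq0; rewrite ?enum_valP //.
by rewrite eq_sym.
Qed.

(** Triangularity is measured by a weight, so the order in which basis vectors are enumerated does
    not matter. A permutation with a nonzero term must lower the weight at every index it moves; as
    it preserves the total weight, it moves none. *)
Lemma det_weight_trig (R : comNzRingType) (m : nat) (M : 'M[R]_m)
    (w : 'I_m -> nat) :
  (forall i j, i != j -> (w i <= w j)%N -> M i j = 0) ->
  \det M = \prod_i M i i.
Proof.
move=> M0; rewrite /determinant (bigD1 1%g) //= odd_perm1 expr0 mul1r.
rewrite [X in _ + X]big1 ?addr0 => [|p ne_p1].
  by apply: eq_bigr => i _; rewrite perm1.
suff [i ne_i le_i] : exists2 i, i != p i & (w i <= w (p i))%N.
  by rewrite (bigD1 i) //= M0 // mul0r mulr0.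
have [i /andP[ne_i le_i] | lt_w] :=
  pickP (fun i => (i != p i) && (w i <= w (p i))%N); first by exists i.
have le_w i : true -> (w (p i) <= w i)%N.
  move=> _; rewrite leqNgt; apply/negP => gt_i; move: (lt_w i).
  by rewrite (ltnW gt_i) andbT => /negbFE/eqP pi; rewrite -pi ltnn in gt_i.
have [i ne_i] : exists i, i != p i.
  apply/existsP; apply: contraR ne_p1; rewrite negb_exists => /forallP fix_p.
  apply/eqP/permP => i; rewrite perm1.
  by apply/esym/eqP; rewrite -[_ == _]negbK.
have lt_i : (w (p i) < w i)%N.
  by move: (lt_w i); rewrite ne_i /= leqNgt => /negbFE.
have : (\sum_i w (p i) < \sum_i w i)%N.
  rewrite (bigD1 i) //= [X in (_ < X)%N](bigD1 i) //=.
  by rewrite -addSn leq_add //; apply: leq_sum => j _; exact: le_w.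
by rewrite [X in (_ < X)%N](reindex_perm p) ltnn.
Qed.

Lemma det_1sub_exterior_power_trig (R : comNzRingType) (n k : nat)
    (T : 'M[R]_n) :
  is_trig_mx T ->
  \det (1%:M - exterior_power k T) =
    \prod_(s in wedge_index n k) (1 - \prod_i T (tnth s i) (tnth s i)).
Proof.
move=> trT.
pose w (i : 'I_#|wedge_index n k|) := (\sum_l tnth (enum_val i) l)%N.
rewrite (det_weight_trig (w := w)) => [|i j ne_ij le_ij].
  rewrite [RHS]big_enum_val; apply: eq_bigr => i _.
  by rewrite !mxE -exterior_power_trig_diag // !mxE eqxx.
rewrite !mxE (negPf ne_ij) sub0r trig_minor_eq0 ?oppr0 ?enum_valP //.
by rewrite (inj_eq enum_val_inj).
Qed.

(** * Similarity and eigenvalues *)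

Lemma similar_char_poly (F : fieldType) (n : nat) (P A B : 'M[F]_n) :
  P \in unitmx -> P *m A = B *m P -> char_poly A = char_poly B.
Proof.
move=> Pu PA_BP; pose P' := map_mx polyC P.
have detP' : \det P' != 0.
  by rewrite det_map_mx polyC_eq0 -unitfE -unitmxE.
apply: (mulfI detP'); rewrite /char_poly -det_mulmx mulrC -det_mulmx.
congr (\det _); rewrite /char_poly_mx mulmxBr mulmxBl -!map_mxM PA_BP.
by rewrite scalar_mxC.
Qed.

Lemma similar_det_1sub_exterior_power (F : fieldType) (n k : nat)
    (P A B : 'M[F]_n) :
  P \in unitmx -> P *m A = B *m P ->
  \det (1%:M - exterior_power k A) = \det (1%:M - exterior_power k B).
Proof.
move=> Pu PA_BP; set W := exterior_power k P.
(* The exterior powers of [P] and of its inverse multiply to the identity. *)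
have detW : \det W != 0.
  apply/eqP => W0.
  have := congr1 (fun M => \det (exterior_power k M)) (mulmxV Pu).
  rewrite exterior_powerM exterior_power1 det_mulmx -/W W0 mul0r det1.
  by move/esym/eqP; rewrite oner_eq0.
apply: (mulfI detW); rewrite -det_mulmx mulrC -det_mulmx; congr (\det _).
by rewrite mulmxBr mulmxBl mulmx1 mul1mx -!exterior_powerM PA_BP.
Qed.

(** Cotrigonalization of the commuting family consisting of [A] alone gives a lower triangular
    matrix similar to [A]; its diagonal serves as [lam] for all [k] at once. *)
Lemma eigenvalues_exterior_power (n : nat) (A : 'M[algC]_n) :
  exists lam : 'I_n -> algC,
    char_poly A = \prod_i ('X - (lam i)%:P) /\
    forall k, \det (1%:M - exterior_power k A) =
      \prod_(s in wedge_index n k) (1 - \prod_i lam (tnth s i)).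
Proof.
have [|P /unitarymx_unit Pu] := @cotrigonalization _ n [:: A].
  by move=> X Y; rewrite !inE => /eqP -> /eqP ->.
rewrite /= andbT => trT; set T := conjmx P A in trT.
have PA : P *m A = T *m P by rewrite /T conjumx // mulmxKV.
exists (fun i => T i i); split=> [|k].
  by rewrite (similar_char_poly Pu PA) char_poly_trig.
rewrite (similar_det_1sub_exterior_power k Pu PA).
exact: det_1sub_exterior_power_trig.
Qed.

(** * Products over one or two indices, and quintics in terms of their roots *)

Lemma prod_wedge_index1 (R : comNzRingType) (n : nat) (F : 'I_n -> R) :
  \prod_(s in wedge_index n 1) F (tnth s ord0) = \prod_i F i.
Proof.
rewrite (reindex (fun i : 'I_n => [tuple i])) /=.
  by apply: eq_bigl => i; rewrite inE.
exists (fun s => tnth s ord0) => [i|s] _ //.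
by apply: eq_from_tnth => i; rewrite (ord1 i).
Qed.

Lemma prod_wedge_index2 (R : comNzRingType) (n : nat) (F : 'I_n -> 'I_n -> R) :
  \prod_(s in wedge_index n 2) F (tnth s ord0) (tnth s ord_max) =
  \prod_(i < n) \prod_(j < n | (i < j)%N) F i j.
Proof.
rewrite pair_big_dep (reindex (fun x : 'I_n * 'I_n => [tuple x.1; x.2])) /=.
  by apply: eq_bigl => x; rewrite inE /= andbT.
exists (fun s => (tnth s ord0, tnth s ord_max)) => [[i j]|s] _ //.
apply: eq_from_tnth => i; rewrite (tnth_nth (tnth s ord0)).
by case: i => [[|[|//]] lt_i] /=; congr (tnth s); apply: val_inj.
Qed.

(** The base ring is arbitrary so that integer quintics can be compared with their images over
    [algC]. *)
Definition quintic (R : comNzRingType) (c0 c1 c2 c3 c4 : R) : {poly R} :=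
  'X^5 + c4 *: 'X^4 + c3 *: 'X^3 + c2 *: 'X^2 + c1 *: 'X + c0%:P.

Lemma quintic_inj (R : comNzRingType) (c0 c1 c2 c3 c4 d0 d1 d2 d3 d4 : R) :
  quintic c0 c1 c2 c3 c4 = quintic d0 d1 d2 d3 d4 ->
  [/\ c0 = d0, c1 = d1, c2 = d2, c3 = d3 & c4 = d4].
Proof.
move=> eq_q; split; [move: (congr1 (coefp 0) eq_q)|move: (congr1 (coefp 1) eq_q)
  |move: (congr1 (coefp 2) eq_q)|move: (congr1 (coefp 3) eq_q)
  |move: (congr1 (coefp 4) eq_q)];
by rewrite /quintic /= !coefE /= ?(mulr0, mulr1, addr0, add0r).
Qed.

Lemma size_quintic (R : comNzRingType) (c0 c1 c2 c3 c4 : R) :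
  size (quintic c0 c1 c2 c3 c4) = 6%N.
Proof.
rewrite /quintic -!addrA size_polyDl size_polyXn // ltnS; apply/leq_sizeP => j.
by do 5![case: j => // j]; rewrite !coefE /= !(mulr0, addr0).
Qed.

Lemma quintic_monic (R : comNzRingType) (c0 c1 c2 c3 c4 : R) :
  quintic c0 c1 c2 c3 c4 \is monic.
Proof.
rewrite monicE lead_coefE size_quintic /quintic !coefE /=.
by rewrite !(mulr0, addr0).
Qed.

(** These are Vieta's formulas in degree 5. *)
Lemma prod_XsubC5 (R : comNzRingType) (a b c d e : R) :
  ('X - a%:P) * ('X - b%:P) * ('X - c%:P) * ('X - d%:P) * ('X - e%:P) =
  quintic
  (- (a * b * c * d * e))
  (a * b * c * d + a * b * c * e + a * b * d * e + a * c * d * e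
     + b * c * d * e)
  (- (a * b * c + a * b * d + a * b * e + a * c * d + a * c * e + a * d * e
     + b * c * d + b * c * e + b * d * e + c * d * e))
  (a * b + a * c + a * d + a * e + b * c + b * d + b * e + c * d
     + c * e + d * e)
  (- (a + b + c + d + e)).
Proof. by rewrite /quintic -!mul_polyC; ring. Qed.

(* Product of the 1 - x_i x_j (i < j) over the roots x_1, ..., x_5 of the monic
   quintic with these coefficients, as shown by [wedge2_polyE]. *)
Definition wedge2_poly (R : comNzRingType) (c0 c1 c2 c3 c4 : R) : R :=
  1 - c3 + c2 * c4 - c2 ^+ 2 - c1 - c1 * c4 ^+ 2 + 2 * c1 * c3 + c1 * c2 * c4
  - c1 ^+ 2 - c1 ^+ 2 * c3 + c1 ^+ 3 + c0 * c4 + c0 * c4 ^+ 3 - 3 * c0 * c3 * c4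
  + c0 * c2 - c0 * c2 * c4 ^+ 2 + 2 * c0 * c2 * c3 + 2 * c0 * c1 * c4
  + c0 * c1 * c3 * c4 - 3 * c0 * c1 * c2 - c0 * c1 ^+ 2 * c4
  - 2 * c0 ^+ 2 - c0 ^+ 2 * c4 ^+ 2 + c0 ^+ 2 * c3 - c0 ^+ 2 * c3 ^+ 2
  + 2 * c0 ^+ 2 * c2 * c4 + c0 ^+ 2 * c1 + c0 ^+ 2 * c1 * c3
  - c0 ^+ 3 * c4 - c0 ^+ 3 * c2 + c0 ^+ 4.

Lemma wedge2_polyE (R : comNzRingType) (a b c d e : R) :
  (1 - a * b) * (1 - a * c) * (1 - a * d) * (1 - a * e) * (1 - b * c) *
  (1 - b * d) * (1 - b * e) * (1 - c * d) * (1 - c * e) * (1 - d * e) =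
  wedge2_poly
  (- (a * b * c * d * e))
  (a * b * c * d + a * b * c * e + a * b * d * e + a * c * d * e
     + b * c * d * e)
  (- (a * b * c + a * b * d + a * b * e + a * c * d + a * c * e + a * d * e
     + b * c * d + b * c * e + b * d * e + c * d * e))
  (a * b + a * c + a * d + a * e + b * c + b * d + b * e + c * d
     + c * e + d * e)
  (- (a + b + c + d + e)).
Proof. rewrite /wedge2_poly. ring. Qed.

(** * The numerical criterion *)

(** Both identities are checked in [algC], into which the integers embed; there the coefficients are
    expressed by the eigenvalues. *)
Lemma quintic_det_1sub_exterior_power (c0 c1 c2 c3 c4 : int) (A : 'M[int]_5) :
  char_poly A = quintic c0 c1 c2 c3 c4 ->
  \det (1%:M - exterior_power 1 A) = 1 + c4 + c3 + c2 + c1 + c0 /\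
  \det (1%:M - exterior_power 2 A) = wedge2_poly c0 c1 c2 c3 c4.
Proof.
move=> fA; pose toC : {rmorphism int -> algC} := intr.
have toC_inj : injective toC by exact: intr_inj.
have detE k : toC (\det (1%:M - exterior_power k A)) =
    \det (1%:M - exterior_power k (map_mx toC A)).
  rewrite -det_map_mx map_mxB map_mx1; congr (\det (_ - _)).
  by apply/matrixP => i j; rewrite !mxE -map_mxsub det_map_mx.
have [lam [lamE lamP]] := eigenvalues_exterior_power (map_mx toC A).
have := lamE; rewrite -map_char_poly fA.
have -> : map_poly toC (quintic c0 c1 c2 c3 c4) =
    quintic (toC c0) (toC c1) (toC c2) (toC c3) (toC c4).
  by rewrite /quintic !rmorphD /= !map_polyZ !map_polyXn map_polyX map_polyC.
rewrite !big_ord_recl big_ord0 mulr1 !mulrA prod_XsubC5.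
case/quintic_inj=> c0E c1E c2E c3E c4E.
split; apply: toC_inj; rewrite detE lamP.
  transitivity (\prod_(s in wedge_index 5 1) (1 - lam (tnth s ord0))).
    by apply: eq_bigr => s _; rewrite big_ord1.
  rewrite (prod_wedge_index1 (fun i => 1 - lam i)) !rmorphD /=.
  rewrite c0E c1E c2E c3E c4E.
  by rewrite !big_ord_recl big_ord0; ring.
transitivity (\prod_(s in wedge_index 5 2)
                 (1 - lam (tnth s ord0) * lam (tnth s ord_max))).
  apply: eq_bigr => s _; rewrite big_ord_recl big_ord1.
  by congr (_ - _ * lam (tnth s _)); apply: val_inj.
have -> : toC (wedge2_poly c0 c1 c2 c3 c4) =
    wedge2_poly (toC c0) (toC c1) (toC c2) (toC c3) (toC c4).
  rewrite /wedge2_poly.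
  by rewrite !(rmorphB, rmorphD, rmorphM, rmorphXn, rmorph1, rmorph_nat).
rewrite (prod_wedge_index2 (fun i j => 1 - lam i * lam j)) c0E c1E c2E c3E c4E.
(* With the condition i < j turned into a conditional factor, the double product unfolds to the ten
   factors of [wedge2_polyE]. *)
rewrite -wedge2_polyE; under eq_bigr do rewrite big_mkcond.
by rewrite !big_ord_recl !big_ord0 /= !(mul1r, mulr1) !mulrA.
Qed.

Lemma cappell_shaneson_quintic (c0 c1 c2 c3 c4 : int) :
  cappell_shaneson_poly 5 (quintic c0 c1 c2 c3 c4) <->
  [/\ c0 = -1, c1 + c2 + c3 + c4 = 1 \/ c1 + c2 + c3 + c4 = -1
    & wedge2_poly c0 c1 c2 c3 c4 = 1 \/ wedge2_poly c0 c1 c2 c3 c4 = -1].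
Proof.
have detE (A : 'M[int]_5) : char_poly A = quintic c0 c1 c2 c3 c4 ->
    \det A = - c0.
  move=> /(congr1 (coefp 0)); rewrite /= char_poly_det /quintic !coefE /=.
  by rewrite !(mulr0, addr0, add0r) => <-; ring.
split=> [[_ _ [A [_ detA csA] /esym fA]]|[c0E sum_c res_c]].
  have [det1 det2] := quintic_det_1sub_exterior_power fA.
  have := csA 1%N isT; have := csA 2%N isT; rewrite det1 det2.
  rewrite (detE A fA) in detA => res_c sum_c; split=> //; lia.
set f := quintic _ _ _ _ _.
have size_f : (size f).-1 = 5%N by rewrite size_quintic.
split; [exact: quintic_monic | exact: size_quintic |].
have [A fA] : exists A : 'M[int]_5, char_poly A = f.
  (* The dimension of [companionmx f] is [(size f).-1], so 5 is first rewritten to that form. *)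
  rewrite -size_f; exists (companionmx f).
  by rewrite companionmxK ?quintic_monic.
have [det1 det2] := quintic_det_1sub_exterior_power fA.
exists A => //; split=> // [|[|[|[|k]]] //= _];
  rewrite ?(detE A fA) ?det1 ?det2 //; lia.
Qed.

(** * Factorisation and the twelve families *)

(** Once [c2] is eliminated through [e], the value plus 1 is a multiple of [c1 + c4]. The values 1
    and -1 thus become factorisations of 2 and of 0. *)
Lemma wedge2_poly_plane (c1 c2 c3 c4 e : int) :
  e = 1 \/ e = -1 -> c1 + c2 + c3 + c4 = e ->
  wedge2_poly (-1) c1 c2 c3 c4 =
  -1 + (c1 + c4) * (e * (5 + c4) - (c1 + c4) * (5 + c3 + 3 * c4 - (c1 + c4))).
Proof.
move=> e1 sum_c; have -> : c2 = e - c1 - c3 - c4 by rewrite -sum_c; ring.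
by case: e1 => ->; rewrite /wedge2_poly; ring.
Qed.

Lemma mulz_eq2 (s m : int) : s * m = 2 ->
  s = 1 /\ m = 2 \/ s = 2 /\ m = 1 \/ s = -1 /\ m = -2 \/ s = -2 /\ m = -1.
Proof.
move=> sm2.
have /dvdn_leq -/(_ isT) : (`|s| %| 2)%N.
  by apply/dvdnP; exists `|m|%N; rewrite mulnC -abszM sm2.
by case: s sm2 => [[|[|[|s]]]|[|[|s]]]; lia.
Qed.

Theorem theorem5p1 (c0 c1 c2 c3 c4 : int) :
  cappell_shaneson_poly 5
    ('X^5 + c4 *: 'X^4 + c3 *: 'X^3 + c2 *: 'X^2 + c1 *: 'X + c0%:P) <->
  exists a b : int,
    (c0, c1, c2, c3, c4) = (-1, - a + 1, 2 * a + 1, - 2 * a - 1, a) \/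
    (c0, c1, c2, c3, c4) = (-1, - 2 * a + 2, 5 * a, - 5 * a - 1, 2 * a) \/
    (c0, c1, c2, c3, c4) = (-1, - a - 1, 4 * a + 15, - 4 * a - 13, a) \/
    (c0, c1, c2, c3, c4) =
      (-1, - 2 * a - 2, 7 * a + 13, - 7 * a - 10, 2 * a) \/
    (c0, c1, c2, c3, c4) = (-1, - a, - b + 1, b, a) \/
    (c0, c1, c2, c3, c4) =
      (-1, (- b + 1) * a + 5, (3 * b - 2) * a - b - 9,
       (- 3 * b + 1) * a + b + 10, a * b - 5) \/
    (c0, c1, c2, c3, c4) = (-1, - a + 1, 4 * a + 9, - 4 * a - 11, a) \/
    (c0, c1, c2, c3, c4) =
      (-1, - 2 * a + 2, 7 * a + 3, - 7 * a - 6, 2 * a) \/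
    (c0, c1, c2, c3, c4) = (-1, - a - 1, 2 * a + 3, - 2 * a - 3, a) \/
    (c0, c1, c2, c3, c4) =
      (-1, - 2 * a - 2, 5 * a + 6, - 5 * a - 5, 2 * a) \/
    (c0, c1, c2, c3, c4) = (-1, - a, - b - 1, b, a) \/
    (c0, c1, c2, c3, c4) =
      (-1, (- b + 1) * a + 5, (3 * b - 2) * a + b - 11,
       (- 3 * b + 1) * a - b + 10, a * b - 5).
Proof.
rewrite -[X in cappell_shaneson_poly 5 X]/(quintic c0 c1 c2 c3 c4).
split=> [/cappell_shaneson_quintic [-> sum_c]|[a [b fam]]]; last first.
  apply/cappell_shaneson_quintic.
  (* The one-parameter families give [wedge2_poly] the value 1, the two-parameter ones the value
     -1. *)
  do 11?[case: fam => [[-> -> -> -> ->]|fam];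
    first by split; [| lia
                    | rewrite /wedge2_poly; (left; ring) || (right; ring)]].
  case: fam => -> -> -> -> ->; split; [by [] | lia |].
  by rewrite /wedge2_poly; right; ring.
have [e [e1 sum_e]] : exists e, (e = 1 \/ e = -1) /\ c1 + c2 + c3 + c4 = e.
  by exists (c1 + c2 + c3 + c4).
rewrite (wedge2_poly_plane e1 sum_e).
set s := c1 + c4; set m := e * _ - _.
have sE : s = c1 + c4 by [].
have mE : m = e * (5 + c4) - s * (5 + c3 + 3 * c4 - s) by [].
case=> sm.
  have {sm}/mulz_eq2 : s * m = 2 by lia.
  case: e1 => eE; rewrite eE in mE sum_e.
    case=> [[s1 m1]|[[s1 m1]|[[s1 m1]|[s1 m1]]]]; rewrite s1 m1 in sE mE.
    (* The eight families with s m = 2 have the single parameter a; 0 is a filler for b. *)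
    - by exists c4, 0; left; congr (_, _, _, _, _); lia.
    (* With s = 2 and m = 1, [mE] reads 5 c4 + 2 c3 + 2 = 0, so c4 is even, and solving for half of
       c4 gives the witness. The other cases with s = 2 or s = -2 are alike. *)
    - have [a aE] : exists a, c4 = 2 * a by exists (- c3 - 2 * c4 - 1); lia.
      by exists a, 0; do 1!right; left; congr (_, _, _, _, _); lia.
    - by exists c4, 0; do 2!right; left; congr (_, _, _, _, _); lia.
    - have [a aE] : exists a, c4 = 2 * a by exists (- c3 - 3 * c4 - 10); lia.
      by exists a, 0; do 3!right; left; congr (_, _, _, _, _); lia.
  case=> [[s1 m1]|[[s1 m1]|[[s1 m1]|[s1 m1]]]]; rewrite s1 m1 in sE mE.
  - by exists c4, 0; do 6!right; left; congr (_, _, _, _, _); lia.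
  - have [a aE] : exists a, c4 = 2 * a by exists (- c3 - 3 * c4 - 6); lia.
    by exists a, 0; do 7!right; left; congr (_, _, _, _, _); lia.
  - by exists c4, 0; do 8!right; left; congr (_, _, _, _, _); lia.
  - have [a aE] : exists a, c4 = 2 * a by exists (- c3 - 2 * c4 - 5); lia.
    by exists a, 0; do 9!right; left; congr (_, _, _, _, _); lia.
have {sm}/eqP : s * m = 0 by lia.
rewrite mulf_eq0 => /orP[]/eqP s_m0; case: e1 => eE; rewrite eE in mE sum_e.
- by exists c4, c3; do 4!right; left; congr (_, _, _, _, _); lia.
- by exists c4, c3; do 10!right; left; congr (_, _, _, _, _); lia.
(* Here m = 0 says that s divides 5 + c4. Taking a = s and b as the quotient, with the sign of [e]
   absorbed in b, gives c4 = a b - 5; the rest is linear in c4, a and b. *)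
- exists s, (5 + c3 + 3 * c4 - s); do 5!right; left; congr (_, _, _, _, _); lia.
- exists s, (- (5 + c3 + 3 * c4 - s)); do 11!right; congr (_, _, _, _, _); lia.
Qed.
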